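(* Let $G$ be a countably infinite, locally finite group. Then a generic element of $\Xi(G)$ (i.e., every element of some comeager subset of $\Xi(G)$) is minimal and uniquely ergodic, its unique invariant measure is good, and the clopen value set of this measure is equal to $$V_G=\{\, i/|K| : i\in\{0,\dots,|K|\},\ K \text{ is a finite subgroup of } G \,\}.$$
   Context: $\Omega$ denotes the Cantor space; $\mathrm{Homeo}(\Omega)$ carries the uniform convergence topology. $\Xi(G)=\mathrm{Hom}(G,\mathrm{Homeo}(\Omega))$ is the Polish space of actions of $G$ on $\Omega$ by homeomorphisms, a closed subspace of $\mathrm{Homeo}(\Omega)^G$. An action is minimal if it has no proper non-empty closed invariant subset, and uniquely ergodic if it has exactly one invariant Borel probability measure. $\mathcal{B}(\Omega)$ is the Boolean algebra of clopen subsets of $\Omega$. The clopen value set of a Borel probability measure $\mu$ on $\Omega$ is $\{\mu(a):a\in\mathcal{B}(\Omega)\}\subseteq[0,1]$. A Borel probability measure $\mu$ on $\Omega$ is good if it is atomless, has full support, and for any $a,b\in\mathcal{B}(\Omega)$ with $\mu(a)<\mu(b)$ there is $c\in\mathcal{B}(\Omega)$ with $c\subseteq b$ and $\mu(c)=\mu(a)$. A group is locally finite if all its finitely generated subgroups are finite. *)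

(* Defs.v *)
From HB Require Import structures.
From mathcomp Require Import all_boot all_order all_algebra finmap.
From mathcomp Require Import all_classical all_reals all_analysis.
From mathcomp Require Import borel_hierarchy.

Set Implicit Arguments.
Unset Strict Implicit.
Unset Printing Implicit Defensive.

Import Order.TTheory GRing.Theory Num.Theory.

Local Open Scope classical_set_scope.
Local Open Scope ring_scope.

Notation Omega := cantor_space.

Definition homeomorphism : set {uniform Omega -> Omega} :=
  [set f | continuous (f : Omega -> Omega) /\
     exists g : Omega -> Omega, [/\ continuous g, cancel f g & cancel g f]].

(* The topology is the subspace topology of the uniform convergence topology
   carried by [{uniform Omega -> Omega}]. *)
Definition Homeo : Type := set_type homeomorphism.

HB.instance Definition _ := Uniform.copy Homeo (set_type homeomorphism).

Definition homeo_fun (f : Homeo) : Omega -> Omega := set_val f.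
Coercion homeo_fun : Homeo >-> Funclass.

Lemma homeo_inj (f g : Homeo) : homeo_fun f = homeo_fun g -> f = g.
Proof. exact: val_inj. Qed.

Lemma homeoP (f : Homeo) : homeomorphism (homeo_fun f).
Proof. exact: set_valP. Qed.

Definition mkHomeo (f : Omega -> Omega) (hf : homeomorphism f) : Homeo :=
  exist (fun f => f \in homeomorphism) f (mem_set hf).

Fact homeo1_subproof : homeomorphism (idfun : Omega -> Omega).
Proof. by split; [move=> x U | exists idfun; split=> // x U]. Qed.

Definition homeo1 : Homeo := mkHomeo homeo1_subproof.

Fact homeoM_subproof (f g : Homeo) :
  homeomorphism (homeo_fun f \o homeo_fun g).
Proof.
have [cf [f' [cf' fK f'K]]] := homeoP f.
have [cg [g' [cg' gK g'K]]] := homeoP g.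
split; first by move=> x; apply: continuous_comp; [exact: cg | exact: cf].
exists (g' \o f'); split.
- by move=> x; apply: continuous_comp; [exact: cf' | exact: cg'].
- exact: can_comp.
- exact: can_comp.
Qed.

Definition homeoM (f g : Homeo) : Homeo :=
  mkHomeo (homeoM_subproof f g).

Fact homeoV_ex (f : Homeo) :
  exists g : Homeo, cancel f g /\ cancel g f.
Proof.
have [cf [f' [cf' fK f'K]]] := homeoP f.
have h : homeomorphism (f' : {uniform Omega -> Omega}).
  by split=> //; exists f; split.
by exists (mkHomeo h).
Qed.

Definition homeoV (f : Homeo) : Homeo := projT1 (cid (homeoV_ex f)).

Fact homeoVK (f : Homeo) : cancel f (homeoV f) /\ cancel (homeoV f) f.
Proof. exact: projT2 (cid (homeoV_ex f)). Qed.

Fact homeoA : associative homeoM.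
Proof. by move=> f g h; apply: homeo_inj. Qed.

Fact homeo1M : left_id homeo1 homeoM.
Proof. by move=> f; apply: homeo_inj. Qed.

Fact homeoM1 : right_id homeo1 homeoM.
Proof. by move=> f; apply: homeo_inj. Qed.

Fact homeoVM : left_inverse homeo1 homeoV homeoM.
Proof.
by move=> f; apply: homeo_inj; apply: funext => x; exact: (homeoVK f).1.
Qed.

Fact homeoMV : right_inverse homeo1 homeoV homeoM.
Proof.
by move=> f; apply: homeo_inj; apply: funext => x; exact: (homeoVK f).2.
Qed.

HB.instance Definition _ :=
  isGroup.Build Homeo homeoA homeo1M homeoM1 homeoVM homeoMV.

(* [{ptws G -> Homeo}] is [Homeo ^ G] with the product topology, and
   [set_type] carries the subspace topology. *)
Definition Xi (G : groupType) : Type :=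
  set_type [set rho : {ptws G -> Homeo} |
    {morph (rho : G -> Homeo) : g h / (g * h)%g}].

HB.instance Definition _ (G : groupType) :=
  Uniform.copy (Xi G) (set_type [set rho : {ptws G -> Homeo} |
    {morph (rho : G -> Homeo) : g h / (g * h)%g}]).

Definition action_of (G : groupType) (rho : Xi G) : G -> Homeo := set_val rho.
Coercion action_of : Xi >-> Funclass.

Definition comeager (T : topologicalType) (A : set T) : Prop :=
  exists2 D : set T, Gdelta_dense D & D `<=` A.

Definition subgroup (G : groupType) (H : set G) : Prop := group_closed (mem H).

Definition locally_finite_group (G : groupType) : Prop :=
  forall S : set G, finite_set S -> finite_set (smallest (@subgroup G) S).

Definition minimal_action (G : groupType) (rho : Xi G) : Prop :=
  forall F : set Omega, closed F -> F !=set0 ->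
    (forall g : G, rho g @` F `<=` F) -> F = setT.

Notation borel_Omega := (g_sigma_algebraType (@open Omega)).

Definition invariant_measure (R : realType) (G : groupType) (rho : Xi G)
    (mu : probability borel_Omega R) : Prop :=
  forall (g : G) (A : set borel_Omega), measurable A ->
    pushforward mu (rho g : borel_Omega -> borel_Omega) A = mu A.

(* Elements of [probability] are functions on all sets, so two of them are the
   same measure when they agree on the measurable sets. *)
Definition uniquely_ergodic (R : realType) (G : groupType) (rho : Xi G)
    : Prop :=
  exists2 mu : probability borel_Omega R, invariant_measure rho mu &
    forall nu : probability borel_Omega R, invariant_measure rho nu ->
      forall A : set borel_Omega, measurable A -> nu A = mu A.

Definition atomless (R : realType) (mu : probability borel_Omega R) : Prop :=
  forall A : set borel_Omega, measurable A -> (0 < mu A)%E ->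
    exists2 B : set borel_Omega, measurable B /\ B `<=` A &
      (0 < mu B < mu A)%E.

Definition full_support (R : realType) (mu : probability borel_Omega R)
    : Prop :=
  forall U : set Omega, open U -> U !=set0 -> (0 < mu U)%E.

Definition good_measure (R : realType) (mu : probability borel_Omega R)
    : Prop :=
  [/\ atomless mu, full_support mu &
    forall a b : set Omega, clopen a -> clopen b -> (mu a < mu b)%E ->
      exists c : set Omega, [/\ clopen c, c `<=` b & mu c = mu a]].

Definition clopen_value_set (R : realType) (mu : probability borel_Omega R)
    : set R :=
  [set fine (mu a) | a in @clopen Omega].

Definition V_ (R : realType) (G : groupType) : set R :=
  [set r | exists (K : set G) (i : nat),
    [/\ subgroup K, finite_set K, (i <= #|` fset_set K|)%N &
        r = i%:R / #|` fset_set K|%:R]].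

(* Main.v *)
Require Import Defs.
From HB Require Import structures.
From mathcomp Require Import all_boot all_order all_algebra finmap.
From mathcomp Require Import all_classical all_reals all_analysis.

(** Why the theorem is true.

Enumerate [G] as [e 0, e 1, ...].  Say that an action [rho] has a tower of
height [n] when there are a finite subgroup [K] containing [e 0, ..., e n] and a
locally constant [K]-equivariant map [p : Omega -> K] whose fibres are so small
that points in the same fibre have the same first [n] coordinates.  The fibres
of [p] are then a clopen partition of [Omega] into [#|K|] pieces which [K]
permutes simply transitively.  The comeager set is the set of the actions that
have towers of every height.

Towers of height [n] form an open set ([open_tower]): a locally constant [p]
stays equivariant for the actions close enough to [rho] on the finite set [K].

They form a dense set ([dense_tower]).  Let [rho] be an action; a neighbourhood
of it only sees a finite subgroup [H] and the first [m >= n] coordinates.  Colour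
[x] by the first [m] coordinates of the points [h x], [h] in [H]; there are
finitely many colours and [H] acts on them.  Since [H] has infinitely many
cosets in [G], there is an [H]-equivariant map [v : G -> Omega] which meets every
colour, already on some large finite subgroup [K].  It remains to find an action
[sigma] of [G] and an equivariant [q : Omega -> K] such that [x] has the colour
of [v (q x)], for then [sigma] and [rho] agree on [H] up to the colours.  For
this, [G] acts by translations on the space of the transversals of the right
cosets of [K], a perfect compact subset of the Cantor space; this space maps
equivariantly to [K], and any two perfect compact sets painted with the same
finite set of colours are homeomorphic through a map that respects the colours
([colored_homeo], [free_action_of_coloring]).

Towers imply the conclusion.  Every orbit visits every fibre of every [p], hence
every cylinder: the action is minimal.  An invariant measure gives the same mass
to all the fibres of [p], so the mass of a clopen set that is a union of [i]
fibres is [i / #|K|] ([measure_coordinate]); since every clopen set is such a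
union for high towers, there is at most one invariant measure, its clopen values
are in [V_ G], and it is good because a union of [j] fibres contains unions of
[i] fibres for [i <= j].  Such a measure exists because the frequency with which
the orbit of a finite group visits a given clopen set does not depend on the
orbit, nor on the group as soon as it is large ([equidistributed_sup]); the
resulting finitely additive function on clopen sets extends to Borel sets
because the Cantor space is compact.  Finally every [i / #|K0|] is a value:
compose [p : Omega -> K] with a [K0]-equivariant map [K -> K0]. *)

Set Implicit Arguments.
Unset Strict Implicit.
Unset Printing Implicit Defensive.
Import Order.TTheory GRing.Theory Num.Theory.

Local Open Scope classical_set_scope.
Local Open Scope card_scope.

(** * The Cantor space in terms of finite prefixes *)

Definition agree (N : nat) (x y : Omega) := forall i, (i < N)%N -> x i = y i.

Lemma agree_sym N x y : agree N x y -> agree N y x.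
Proof. by move=> xy i iN; rewrite xy. Qed.

Lemma agree_trans N y x z : agree N x y -> agree N y z -> agree N x z.
Proof. by move=> xy yz i iN; rewrite xy// yz. Qed.

Lemma agree_le M N x y : (M <= N)%N -> agree N x y -> agree M x y.
Proof. by move=> MN xy i iM; apply: xy; apply: leq_trans MN. Qed.

(** The form in which finiteness, of a subgroup or of a subcover, is used to make
    a bound uniform. *)
Lemma finite_common_bound (T : Type) (A : set T) (P : T -> nat -> Prop) :
  finite_set A -> (forall a M N, (M <= N)%N -> P a M -> P a N) ->
  (forall a, A a -> exists N, P a N) -> exists N, forall a, A a -> P a N.
Proof.
move=> finA Pmono PA.
have /choice[f fP] a : exists N, A a -> P a N.
  have [/PA[N PN]|nAa] := pselect (A a); first by exists N.
  by exists 0%N.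
have /finite_seqP[s sE] := finite_image f finA.
exists (\max_(i <- s) i)%N => a Aa; apply: Pmono (fP a Aa).
have fas : f a \in s.
  have : (f @` A) (f a) by exists a.
  by rewrite sE.
exact: (leq_bigmax_seq _ fas).
Qed.

Lemma continuous_coord i : continuous (fun x : Omega => x i).
Proof. exact: (@proj_continuous nat (fun _ => bool) i). Qed.

Lemma clopen_coord i (b : bool) : clopen [set x : Omega | x i = b].
Proof.
apply: (@preimage_clopen Omega bool (fun x => x i) [set b]); last first.
  exact: continuous_coord.
by split; [exact: discrete_open | exact: discrete_closed].
Qed.

Lemma nbhs_agree (x : Omega) (U : set Omega) :
  nbhs x U <-> exists N, forall y, agree N x y -> U y.
Proof.
split=> [xU|[N NU]].
  apply: contrapT => /forallNP noN.
  have /choice[g gP] N : exists y, agree N x y /\ ~ U y.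
    by have /existsNP[y /not_implyP] := noN N; exists y.
  (* Counterexamples [g N] to all the bounds [N] would converge to [x]. *)
  suff gx : g @ \oo --> x.
    by have [N _ /(_ N (leqnn N))] := gx _ xU; apply: (gP N).2.
  apply/cvg_sup => i V [W [[B oB <-] Bxi] WV].
  apply: (filterS WV); exists i.+1 => // N /= iN.
  by rewrite -((gP N).1 i iN).
suff : nbhs x [set y | agree N x y] by apply: filterS.
elim: N {NU} => [|N IH].
  by apply: (@filterS _ _ (nbhs_filter x) setT) => //; exact: filterT.
have xN : nbhs x [set y : Omega | y N = x N].
  by apply: open_nbhs_nbhs; split=> //; have [] := clopen_coord N (x N).
apply: filterS (filterI IH xN) => y [xy yN] i.
by rewrite ltnS leq_eqVlt => /predU1P[->|/xy].
Qed.

Lemma open_agree (U : set Omega) :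
  open U <-> forall x, U x -> exists N, forall y, agree N x y -> U y.
Proof.
rewrite openE; split=> UP x /UP; first by move=> /nbhs_agree.
by move=> UN; apply/nbhs_agree.
Qed.

(** Together with [agree_entourage]: the relations [agree N] are a base of the uniformity
    of the Cantor space, so that nearness of maps can be stated with them. *)
Lemma entourage_agree N : entourage [set xy : Omega * Omega | agree N xy.1 xy.2].
Proof.
elim: N => [|N IH].
  apply: (@filterS _ entourage _ setT); last exact: filterT.
  by move=> xy _ i.
suff eN : entourage [set xy : Omega * Omega | xy.1 N = xy.2 N].
  apply: filterS (filterI IH eN) => -[x y] /= [xy yN] i.
  by rewrite ltnS leq_eqVlt => /predU1P[->|/xy].
have entb : @entourage (initial_topology (@proj _ (fun _ : nat => bool) N))
    [set xy | xy.1 N = xy.2 N].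
  exists [set ab | ab.1 = ab.2]; last by [].
  by move=> _ [a _ <-].
have entP : `[< @entourage
   (Uniform.Pack (Uniform.class (initial_topology (@proj _ (fun _ : nat => bool) N))))
   [set xy | xy.1 N = xy.2 N] >] by apply/asboolP.
exists [set xy : Omega * Omega | xy.1 N = xy.2 N]; last by [].
exists [fset exist _ (N : {classic nat}, [set xy : Omega * Omega | xy.1 N = xy.2 N]) entP]%fset.
  by move=> ? _; exact: in_setT.
by rewrite set_fset1 bigcap_set1.
Qed.

Lemma agree_entourage (E : set (Omega * Omega)) : entourage E ->
  exists N, forall x y, agree N x y -> E (x, y).
Proof.
case=> D [F _ <-] DE.
suff [N NP] : exists N, forall ie, ie \in F ->
    forall x y, agree N x y -> (projT1 ie).2 (x, y).
  by exists N => x y xy; apply: DE => ie ieF; apply: NP ieF _ _ xy.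
have := @finite_common_bound _ [set` F]
  (fun ie N => forall x y, agree N x y -> (projT1 ie).2 (x, y)).
move=> /(_ (finite_fset F)) []; last by move=> N NP; exists N.
- by move=> ie M N MN MP x y /(agree_le MN)/MP.
- move=> [[i A] /= /asboolP[B entB BA] _]; exists i.+1 => x y xy.
  apply: BA => /=; apply: entB; exists (y i) => //.
  by congr (_, _); apply/esym; apply: xy.
Qed.

Lemma closed_compact_Omega (A : set Omega) : closed A -> compact A.
Proof.
by move=> cA; apply: (subclosed_compact cA cantor_space_compact) => x.
Qed.

(** Compactness in its combinatorial form; uniform continuity and the description
    of clopen sets are instances of it. *)
Lemma closed_disjoint_separated (A B : set Omega) : closed A -> closed B ->
  A `&` B = set0 -> exists M, forall a b, A a -> B b -> ~ agree M a b.
Proof.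
move=> cA cB AB0.
have := closed_compact_Omega cA; rewrite compact_cover.
move=> /(_ nat setT (fun M => [set x | forall b, B b -> ~ agree M x b])).
case; [move=> M _|move=> a Aa|move=> D _ AD].
- apply/open_agree => x xM; exists M => y xy b Bb yb.
  exact: xM (agree_trans xy yb).
- have : (~` B) a by move=> Ba; suff : (A `&` B) a by rewrite AB0.
  move/closed_openC: cB => /open_agree /[apply] -[M MB].
  by exists M => //= b Bb /MB.
- have [||//|M MD] := @finite_common_bound _ [set` D] (fun i N => (i <= N)%N).
  + exact: finite_fset.
  + by move=> a M N MN aM; apply: leq_trans MN.
  + by move=> i _; exists i.
  exists M => a b /AD[i Di /=] aiB Bb ab.
  by apply: (aiB b Bb); apply: agree_le ab; apply: MD.
Qed.

(** Uniform continuity on [A].  Unlike continuity, it makes maps between subsets of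
    [Omega] composable without introducing subspaces. *)
Definition ucont (A : set Omega) (f : Omega -> Omega) := forall N, exists M,
  forall x y, A x -> A y -> agree M x y -> agree N (f x) (f y).

Lemma ucont_coord (A : set Omega) (f : Omega -> Omega) :
  (forall i, exists M, forall x y, A x -> A y -> agree M x y -> f x i = f y i) ->
  ucont A f.
Proof.
move=> fM N.
have [|||M MP] := @finite_common_bound _ `I_N
  (fun i M => forall x y, A x -> A y -> agree M x y -> f x i = f y i).
- exact: finite_II.
- by move=> i M1 M2 M12 M1P x y Ax Ay /(agree_le M12); apply: M1P.
- by move=> i _; apply: fM.
by exists M => x y Ax Ay xy i iN; apply: MP.
Qed.

Lemma continuous_ucont (f : Omega -> Omega) : continuous f -> ucont setT f.
Proof.
move=> cf; apply: ucont_coord => // i.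
have cl b : closed [set x | f x i = b].
  have [_ cb] := clopen_coord i b.
  by apply: closed_comp cb => x _; apply: cf.
have [|M MP] := closed_disjoint_separated (cl true) (cl false).
  by apply/seteqP; split=> // x [/= ->].
exists M => x y _ _ xy; case fx: (f x i); case fy: (f y i) => //.
- by case: (MP x y fx fy).
- by case: (MP y x fy fx); apply: agree_sym.
Qed.

Lemma ucont_continuous (f : Omega -> Omega) : ucont setT f -> continuous f.
Proof.
move=> uf x U /nbhs_agree[N NU].
rewrite nbhs_simpl; have [M MP] := uf N.
by apply/nbhs_agree; exists M => y /MP xy; apply: NU; apply: xy.
Qed.

Lemma ucont_comp (A B : set Omega) (f g : Omega -> Omega) :
  (forall x, A x -> B (f x)) -> ucont A f -> ucont B g -> ucont A (g \o f).
Proof.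
move=> fAB uf ug N; have [M MP] := ug N; have [L LP] := uf M.
by exists L => x y Ax Ay xy; apply: MP; [exact: fAB|exact: fAB|exact: LP].
Qed.

(** A continuous injection on a compact space is an embedding: the images of the
    two halves given by one coordinate are closed and disjoint. *)
Lemma inj_continuous_agree (g : Omega -> Omega) : continuous g -> injective g ->
  forall N, exists M, forall x y, agree M (g x) (g y) -> agree N x y.
Proof.
move=> cg ig N.
have cl i b : closed (g @` [set x | x i = b]).
  apply: (compact_closed cantor_space_hausdorff).
  apply: (@continuous_compact _ _ g); first exact: continuous_subspaceT.
  by apply: closed_compact_Omega; have [] := clopen_coord i b.
have [|||M MP] := @finite_common_bound _ `I_N
  (fun i M => forall x y, agree M (g x) (g y) -> x i = y i).
- exact: finite_II.
- by move=> i M1 M2 M12 M1P x y /(agree_le M12); apply: M1P.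
- move=> i _; have [|M MP] := closed_disjoint_separated (cl i true) (cl i false).
    by apply/seteqP; split=> // _ [[x /= xi <-] [y /= yi /ig yx]]; rewrite yx xi in yi.
  exists M => x y gxy; case xi: (x i); case yi: (y i) => //.
  + by case: (MP (g x) (g y)); [exists x|exists y|].
  + by case: (MP (g y) (g x)); [exists y|exists x|exact: agree_sym].
by exists M => x y xy i iN; apply: MP.
Qed.

Definition determined (X : Type) (N : nat) (A : set Omega) (c : Omega -> X) :=
  forall x y, A x -> A y -> agree N x y -> c x = c y.

Lemma clopen_determined (a : set Omega) :
  clopen a <-> exists N, forall x y, agree N x y -> a x -> a y.
Proof.
split=> [[oa ca]|[N aN]].
  have [|M MP] := closed_disjoint_separated ca (open_closedC oa).
    exact: setICr.
  exists M => x y xy ax; apply: contrapT => nay; exact: (MP x y ax nay).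
split; first by apply/open_agree => x ax; exists N => y /aN; apply.
rewrite -[a]setCK; apply: open_closedC; apply/open_agree => x nax.
by exists N => y xy ay; apply: nax; apply: aN ay; apply: agree_sym.
Qed.

Lemma determined_finite_range (X : Type) (N : nat) (c : Omega -> X) :
  (forall x y, agree N x y -> c x = c y) -> finite_set (range c).
Proof.
move=> cN.
pose ext (t : N.-tuple bool) : Omega := fun i => nth false t i.
suff -> : range c = range (c \o ext) by apply: finite_image; exact: finite_finset.
apply/seteqP; split=> [_ [x _ <-]|_ [t _ <-]]; last by exists (ext t).
exists [tuple x i | i < N] => //=; apply: cN => i iN.
by rewrite /ext (nth_mktuple _ _ (Ordinal iN)).
Qed.

(** * Coloured perfect subsets of the Cantor space *)

Definition no_isolated_point (A : set Omega) :=
  forall x N, A x -> exists y, [/\ A y, y <> x & agree N x y].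

(** Brouwer's characterization of the Cantor space, applied to the subtype given by
    [A] and transported back to a pair of maps between [Omega] and [A].  The real
    type [R] only serves to measure distances. *)
Lemma perfect_closed_homeo_Omega (R : realType) (A : set Omega) :
  closed A -> A !=set0 -> no_isolated_point A ->
  exists e e' : Omega -> Omega, [/\ (forall x, A (e x)), cancel e e',
    (forall y, A y -> e (e' y) = y), ucont setT e & ucont A e'].
Proof.
move=> cA [a0 Aa0] pA.
pose B := A : set (prod_topology (fun _ : nat => bool)).
pose T0 : pseudoMetricType R := set_type B.
pose pt : T0 := exist _ a0 (mem_set Aa0).
pose T : pseudoPMetricType R := HB.pack (PseudoMetric.sort T0) (isPointed.Build T0 pt).
pose v : T -> Omega := set_val.
have cv : continuous v by exact: initial_continuous.
have vA t : A (v t) by exact: set_valP.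
have vinj : injective v by exact: val_inj.
have vsurj x : A x -> exists t, v t = x.
  by move=> Ax; exists (exist _ x (mem_set Ax)).
have openTP (U : set T) t : open U -> U t ->
    exists N, forall s, agree N (v t) (v s) -> U s.
  move=> [V oV <-] Vt.
  by have /open_agree/(_ _ Vt)[N NV] := oV; exists N => s /NV.
have zT : zero_dimensional T.
  move=> x y /eqP xy.
  have [i xyi] : exists i, v x i <> v y i.
    apply: contrapT => /forallNP xyE; apply/xy/vinj/funext => i.
    by have /contrapT := xyE i.
  exists (v @^-1` [set z | z i = v x i]); split=> //; last exact/nesym.
  by apply: preimage_clopen cv; exact: clopen_coord.
have cantorT : cantor_like T.
  split=> //.
  - apply/perfectTP_ex => U oU [x Ux].
    have [N NU] := openTP _ _ oU Ux.
    have [y [Ay yx xy]] := pA (v x) N (vA x).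
    have [t tE] := vsurj y Ay.
    exists x, t; split=> //; first by apply: NU; rewrite tE.
    by apply/eqP => xt; apply: yx; rewrite xt.
  - move=> F PF _.
    have vFA : (v @ F) A.
      have vAT : v @^-1` A = setT by apply/seteqP; split=> t _ //; exact: vA.
      by rewrite /fmap /= vAT; exact: filterT.
    have [a [Aa clFa]] := closed_compact_Omega cA (fmap_proper_filter v PF) vFA.
    have [t tE] := vsurj a Aa; exists t; split=> // X C FX [_ [[V oV <-] Vt VC]].
    have aV : nbhs a V by apply: open_nbhs_nbhs; rewrite -tE.
    have FvX : (v @ F) (v @` X).
      by apply: (@filterS _ _ (@filter_filter _ _ PF) _ _ _ FX) => s Xs; exists s.
    have [_ [[s Xs <-] Vs]] := clFa _ _ FvX aV.
    by exists s; split=> //; apply: VC.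
  - move=> p q clpq; apply: contrapT => /eqP pq.
    have [U [[oU cU] Up Uq]] := zT _ _ pq.
    have [||z [Uz nUz]] := clpq U (~` U) => //.
      exact: open_nbhs_nbhs.
    by apply: open_nbhs_nbhs; split=> //; exact: closed_openC.
have [f [cf _]] := homeomorphism_cantor_like cantorT.
have finj : injective f by move=> x y; apply: inj; rewrite ?inE.
have ce : continuous (v \o f).
  by move=> x; apply: continuous_comp; [exact: cf | exact: cv].
have esurj y : exists x, A y -> v (f x) = y.
  have [Ay|] := pselect (A y); last by exists point.
  have [t tE] := vsurj y Ay.
  by have [x _ xt] := @surj _ _ _ _ f t I; exists x => _; rewrite xt.
have [e' e'P] := choice esurj.
have einj : injective (v \o f) by apply: inj_comp.
exists (v \o f), e'; split=> //; first by move=> x; apply: vA.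
- move=> x; have := e'P (v (f x)) (vA _); exact: einj.
- exact: continuous_ucont.
- move=> N; have [M MP] := inj_continuous_agree ce einj N.
  by exists M => x y Ax Ay xy; apply: MP; rewrite /= !e'P.
Qed.

(** Each colour class of [S] and of [T] is a nonempty perfect closed set, hence a copy
    of [Omega]; the homeomorphism is obtained by glueing those between classes of
    the same colour, which are clopen and finite in number. *)
Lemma colored_homeo (R : realType) (X : Type) (S T : set Omega)
    (a c : Omega -> X) (N : nat) :
  closed S -> no_isolated_point S -> closed T -> no_isolated_point T ->
  determined N S a -> determined N T c -> a @` S = c @` T ->
  finite_set (a @` S) ->
  exists t t' : Omega -> Omega,
   [/\ (forall x, S x -> T (t x) /\ t' (t x) = x),
       (forall y, T y -> S (t' y) /\ t (t' y) = y),
       (forall x, S x -> c (t x) = a x), ucont S t & ucont T t'].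
Proof.
have ext (U : set Omega) (b : Omega -> X) : closed U -> no_isolated_point U ->
    determined N U b -> exists e e' : X -> Omega -> Omega,
    forall z, (b @` U) z -> [/\ (forall x, U (e z x) /\ b (e z x) = z),
      cancel (e z) (e' z),
      (forall y, U y -> b y = z -> e z (e' z y) = y),
      ucont setT (e z) & ucont (U `&` [set y | b y = z]) (e' z)].
  move=> cU pU bN.
  have H z : exists ee : (Omega -> Omega) * (Omega -> Omega), (b @` U) z ->
    [/\ (forall x, U (ee.1 x) /\ b (ee.1 x) = z),
      cancel ee.1 ee.2,
      (forall y, U y -> b y = z -> ee.1 (ee.2 y) = y),
      ucont setT ee.1 & ucont (U `&` [set y | b y = z]) ee.2].
    have [[x0 Ux0 x0z]|] := pselect ((b @` U) z); last by exists (idfun, idfun).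
    have [|||e [e' [eA eK e'K ue ue']]] :=
        @perfect_closed_homeo_Omega R (U `&` [set y | b y = z]).
    - rewrite -[X in closed X]setCK; apply: open_closedC; apply/open_agree.
      move=> x xU; have [Ux|nUx] := pselect (U x); last first.
        have /open_agree/(_ x nUx)[M MU] := closed_openC cU.
        by exists M => y /MU nUy [].
      exists N => y xy [Uy /= yz]; apply: xU; split=> //=.
      by rewrite -yz; apply: bN.
    - by exists x0.
    - move=> x M [Ux /= xz].
      have [y [Uy yx xy]] := pU x (maxn M N) Ux.
      exists y; split=> //; last by apply: agree_le xy; exact: leq_maxl.
      split=> //=; rewrite -xz; apply: bN => //.
      by apply/agree_sym/(agree_le _ xy)/leq_maxr.
    exists (e, e') => _; split=> //= y Uy yz; exact: e'K.
  have [ee eeP] := choice H.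
  by exists (fun z => (ee z).1), (fun z => (ee z).2).
move=> cS pS cT pT aN cN acE fin.
have [e [e' eP]] := ext S a cS pS aN.
have [d [d' dP]] := ext T c cT pT cN.
have aS x : S x -> (a @` S) (a x) by exists x.
have cT' y : T y -> (a @` S) (c y) by rewrite acE; exists y.
have acz z : (a @` S) z -> (c @` T) z by rewrite acE.
have glue (U : set Omega) (b : Omega -> X) (f g : X -> Omega -> Omega) :
    determined N U b -> finite_set (b @` U) ->
    (forall z, (b @` U) z -> ucont (U `&` [set y | b y = z]) (f z)) ->
    (forall z, (b @` U) z -> ucont setT (g z)) ->
    ucont U (fun x => g (b x) (f (b x) x)).
  move=> bN finb uf ug L.
  have [||M MP] := @finite_common_bound _ (b @` U) (fun z M =>
     forall x y, U x -> U y -> b x = z -> b y = z -> agree M x y ->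
     agree L (g z (f z x)) (g z (f z y))) finb.
  - by move=> z M1 M2 M12 M1P x y Ux Uy xz yz /(agree_le M12); apply: M1P.
  - move=> z Uz; have [M1 gM1] := ug z Uz L; have [M2 fM2] := uf z Uz M1.
    by exists M2 => x y Ux Uy xz yz xy; apply: gM1 => //; apply: fM2.
  exists (maxn M N) => x y Ux Uy xy.
  have xyb : b x = b y by apply: bN => //; apply: agree_le xy; exact: leq_maxr.
  rewrite -xyb; apply: (MP (b x)) => //.
  by apply: agree_le xy; exact: leq_maxl.
exists (fun x => d (a x) (e' (a x) x)), (fun y => e (c y) (d' (c y) y)).
split.
- move=> x Sx; have az := aS x Sx; have [ez _ eK _ _] := eP _ az.
  have [dz dK _ _ _] := dP _ (acz _ az).
  by split; [exact: (dz _).1 | rewrite (dz _).2 dK eK].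
- move=> y Ty; have az := cT' y Ty; have [ez eK _ _ _] := eP _ az.
  have [dz _ dK _ _] := dP _ (acz _ az).
  by split; [exact: (ez _).1 | rewrite (ez _).2 eK dK].
- move=> x Sx; have az := aS x Sx.
  have [dz _ _ _ _] := dP _ (acz _ az).
  exact: (dz _).2.
- apply: (@glue S a e' d aN fin) => z az; first by have [] := eP _ az.
  by rewrite acE in az; have [] := dP _ az.
- apply: (@glue T c d' e cN) => [|z|z]; rewrite -acE //.
    by rewrite acE => az; have [] := dP _ az.
  by move=> az; have [] := eP _ az.
Qed.

(** * The space of actions *)

Section actions.
Local Open Scope group_scope.
Variable G : groupType.
Implicit Types (rho sigma : Xi G) (g h : G) (x y : Omega).

Lemma actionM rho g h x : rho (g * h) x = rho g (rho h x).
Proof. exact: (congr1 (fun f : Homeo => f x) (set_valP rho g h)). Qed.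

Lemma action1 rho x : rho 1 x = x.
Proof.
have inj1 : injective (rho 1) by exact: can_inj (homeoVK (rho 1)).1.
by apply: inj1; rewrite -actionM mulg1.
Qed.

Lemma action_continuous rho g : continuous (rho g).
Proof. by have [] := homeoP (rho g). Qed.

Lemma exists_action (act : G -> Omega -> Omega) :
  (forall g, continuous (act g)) -> (forall x, act 1 x = x) ->
  (forall g h x, act (g * h) x = act g (act h x)) ->
  exists rho : Xi G, forall g x, rho g x = act g x.
Proof.
move=> cact act1 actM.
have hact g : homeomorphism (act g : {uniform Omega -> Omega}).
  split; first exact: cact.
  exists (act g^-1); split; first exact: cact.
    by move=> x; rewrite -actM mulVg act1.
  by move=> x; rewrite -actM mulgV act1.
pose r g := mkHomeo (hact g).
have rP : [set rho : {ptws G -> Homeo} |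
    {morph (rho : G -> Homeo) : g h / (g * h)%g}] r.
  by move=> g h; apply: homeo_inj; apply: funext => x; exact: actM.
by exists (exist (fun r => r \in [set rho : {ptws G -> Homeo} |
    {morph (rho : G -> Homeo) : g h / (g * h)%g}]) r (mem_set rP)).
Qed.

Lemma nbhs_Homeo_close (f : Homeo) N :
  nbhs f [set f' : Homeo | forall x, agree N (f x) (f' x)].
Proof.
have nV : nbhs (set_val f : {uniform Omega -> Omega})
    [set h | forall y, agree N (f y) (h y)].
  apply/uniform_nbhs; exists [set xy | agree N xy.1 xy.2]; split.
    exact: entourage_agree.
  by move=> h fh y; apply: fh.
exact: (@initial_continuous _ _ (set_val : Homeo -> _) f _ nV).
Qed.

Lemma entourage_Homeo (E : set (Homeo * Homeo)) : entourage E ->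
  exists N, forall f f' : Homeo, (forall x, agree N (f x) (f' x)) -> E (f, f').
Proof.
case=> B entB BE; move: entB; rewrite uniform_entourage => -[C entC CB].
have [N NC] := agree_entourage entC.
by exists N => f f' ff'; apply: BE; apply: CB => x _; apply/NC/ff'.
Qed.

(** A neighbourhood in the product restricts finitely many coordinates, each of them up
    to an entourage of [Homeo]. *)
Lemma nbhs_Xi rho (U : set (Xi G)) : nbhs rho U -> exists (F : set G) N,
  finite_set F /\ forall sigma, (forall g, F g -> forall x,
    agree N (rho g x) (sigma g x)) -> U sigma.
Proof.
rewrite -nbhs_entourageE => -[E [E' [D [F _ <-] DE'] E'E] EU].
have [||N NP] := @finite_common_bound _ [set` F] (fun ie N => forall r r' : G -> Homeo,
    (forall x, agree N (r (projT1 ie).1 x) (r' (projT1 ie).1 x)) ->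
    (projT1 ie).2 (r, r')) (finite_fset F).
- by move=> ie M N MN MP r r' rr'; apply: MP => x; exact: agree_le (rr' x).
- move=> [[g A] /= /asboolP[B entB BA] _]; have [N NB] := entourage_Homeo entB.
  by exists N => r r' rr'; apply: BA; apply: NB.
exists ((fun ie => (projT1 ie).1) @` [set` F]), N; split.
  exact/finite_image/finite_fset.
move=> sigma close; apply/EU/mem_set/E'E/DE' => ie ieF.
by apply: NP => // x; apply: close; exists ie.
Qed.

Lemma nbhs_Xi_close rho g N :
  nbhs rho [set sigma : Xi G | forall x, agree N (rho g x) (sigma g x)].
Proof.
have cg : continuous (fun r : {ptws G -> Homeo} => r g).
  exact: (@proj_continuous G (fun _ => Homeo) g).
have nV := cg (set_val rho) _ (nbhs_Homeo_close (rho g) N).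
exact: (@initial_continuous _ _ (set_val : Xi G -> _) rho _ nV).
Qed.

End actions.

(** * Finite subgroups and coset representatives *)

Section groups.
Local Open Scope group_scope.
Variable G : groupType.
Implicit Types (K : set G) (g h k : G).

Lemma subgroup1 K : subgroup K -> K 1.
Proof. by case=> /set_mem. Qed.

Lemma subgroupV K k : subgroup K -> K k -> K k^-1.
Proof. by move=> /group_closedV KV Kk; have /set_mem := KV k (mem_set Kk). Qed.

Lemma subgroupM K g h : subgroup K -> K g -> K h -> K (g * h).
Proof.
move=> /group_closedM KM Kg Kh.
by have /set_mem := KM g h (mem_set Kg) (mem_set Kh).
Qed.

Lemma finite_subset_subgroup (S : set G) : locally_finite_group G ->
  finite_set S -> exists K, [/\ subgroup K, finite_set K & S `<=` K].
Proof.
move=> lf finS; exists (smallest (@subgroup G) S); split; last 2 first.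
- exact: lf.
- exact: sub_gen_smallest.
split; first by apply/mem_set => A [Asub _]; exact: subgroup1.
move=> x y /set_mem xS /set_mem yS; apply/mem_set => A SA.
have [Asub _] := SA.
by apply: subgroupM (xS _ SA) _ => //; apply: subgroupV (yS _ SA).
Qed.

(** If [r g] is a representative of the right coset of [g], which only depends on the
    coset, then [kappa g = g (r g)^-1] is [K]-valued and equivariant, and
    [kappa g^-1 * g] is [r g]. *)
Lemma coset_factor K : subgroup K -> exists kappa : G -> G,
  [/\ forall g, K (kappa g),
      forall k g, K k -> kappa (k * g) = k * kappa g &
      forall g, kappa ((kappa g)^-1 * g) = 1].
Proof.
move=> sK.
pose r g := xget 1 [set k * g | k in K].
have rP g : exists2 k, K k & r g = k * g.
  have [|k Kk rk] := @xgetPex _ 1 [set k * g | k in K].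
    by exists g; exists 1; [exact: subgroup1 | rewrite mul1g].
  by exists k.
have rM k g : K k -> r (k * g) = r g.
  move=> Kk; rewrite /r; congr (xget _ _); apply/seteqP; split=> [_ [h Kh <-]|_ [h Kh <-]].
    by exists (h * k); [exact: subgroupM | rewrite mulgA].
  exists (h * k^-1); first by apply: subgroupM => //; exact: subgroupV.
  by rewrite mulgA mulgVK.
have kK g : K (g * (r g)^-1).
  have [k Kk ->] := rP g.
  by rewrite invgM mulgA mulgV mul1g; exact: subgroupV.
have kM k g : K k -> k * g * (r (k * g))^-1 = k * (g * (r g)^-1).
  by move=> Kk; rewrite rM// mulgA.
exists (fun g => g * (r g)^-1); split=> // g.
by rewrite kM ?mulVg//; exact: subgroupV.
Qed.

End groups.

(** * Extending free actions of finite subgroups *)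

(** Such a [p] exists exactly when [K] acts freely with a clopen fundamental domain,
    namely the fibre of [p] over [1]. *)
Definition coordinate (G : groupType) (rho : Xi G) (K : set G) (p : Omega -> G) :=
  [/\ forall x, K (p x),
      exists N, forall x y, agree N x y -> p x = p y &
      forall k x, K k -> p (rho k x) = (k * p x)%g].

Section free_action.
Local Open Scope group_scope.
Variables (R : realType) (G : groupType) (e : nat -> G) (e' : G -> nat).
Hypotheses (eK : cancel e e') (e'K : cancel e' e).
Variables (K : set G) (k1 : G).
Hypotheses (sK : subgroup K) (finK : finite_set K) (Kk1 : K k1) (k1N1 : k1 <> 1).

Let translate (g : G) (x : Omega) : Omega := fun n => x (e' (e n * g)).

Let translateE g x h : translate g x (e' h) = x (e' (h * g)).
Proof. by rewrite /translate e'K. Qed.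

Let translate1 x : translate 1 x = x.
Proof. by apply: funext => n; rewrite /translate mulg1 eK. Qed.

Let translateM g h x : translate (g * h) x = translate g (translate h x).
Proof. by apply: funext => n; rewrite /translate e'K mulgA. Qed.

Let ucont_translate g : ucont setT (translate g).
Proof.
apply: ucont_coord => i; exists (e' (e i * g)).+1 => x y _ _ xy.
by apply: xy.
Qed.

(** A point [x] of the Cantor space is read as the set of the [g] with [x (e' g)]; those
    below meet each right coset [K g] in one point.  Right translations of [G] permute
    them, and this is the action of [G] coinduced from [K] acting on itself. *)
Definition transversals : set Omega :=
  [set x | forall g, exists k, [/\ K k, x (e' (k * g)) &
     forall h, K h -> x (e' (h * g)) -> h = k]].

Let Y := transversals.

Let coset_bound g : exists N, forall k, K k -> (e' (k * g) < N)%N.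
Proof.
apply: (@finite_common_bound _ K (fun k N => (e' (k * g) < N)%N)) => //.
- by move=> k M N MN kM; apply: leq_trans MN.
- by move=> k _; exists (e' (k * g)).+1.
Qed.

Let transversals_translate g x : Y x -> Y (translate g x).
Proof.
move=> Yx h; have [k [Kk xk kP]] := Yx (h * g).
exists k; split=> //; first by rewrite translateE -mulgA.
by move=> l Kl; rewrite translateE -mulgA; apply: kP.
Qed.

Let transversals_closed : closed Y.
Proof.
rewrite -[Y]setCK; apply: open_closedC; apply/open_agree => x /existsNP[g xg].
have [N NP] := coset_bound g; exists N => y xy Yy; apply: xg.
have [k [Kk yk kP]] := Yy g; exists k; split=> //; first by rewrite xy ?NP.
by move=> h Kh; rewrite xy ?NP//; apply: kP.
Qed.

Let transversals_nonempty : Y !=set0.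
Proof.
have [kappa [kK kM _]] := coset_factor sK.
exists (fun n => `[< kappa (e n) = 1 >]) => g.
exists (kappa g)^-1; split; first exact: subgroupV.
  by apply/asboolP; rewrite e'K kM ?mulVg//; exact: subgroupV.
move=> h Kh /asboolP; rewrite e'K kM// => hg.
by rewrite -[h](mulgK (kappa g)) hg mul1g.
Qed.

(** A transversal can be changed in a coset that avoids the first [N] elements of [G]. *)
Let transversals_perfect : no_isolated_point Y.
Proof.
move=> x N Yx.
have [g gP] : exists g, forall k, K k -> (N <= e' (k * g))%N.
  apply: contrapT => /forallNP noG.
  suff : finite_set [set: nat] by exact: infinite_nat.
  have finB : finite_set [set e' (k^-1 * e i) | k in K & i in `I_N].
    apply: finite_image2 => //; exact: finite_II.
  apply: sub_finite_set finB => n _.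
  have /existsNP[k /not_implyP[Kk /negP]] := noG (e n).
  rewrite -ltnNge => kN; exists k => //; exists (e' (k * e n)) => //.
  by rewrite e'K mulgA mulVg mul1g eK.
pose C h := exists2 k, K k & h = k * g.
have CK h k : K k -> C (k * h) <-> C h.
  move=> Kk; split=> -[l Kl lE].
    exists (k^-1 * l); first by apply: subgroupM => //; exact: subgroupV.
    by rewrite -mulgA -lE mulgA mulVg mul1g.
  by exists (k * l); [exact: subgroupM | rewrite lE mulgA].
pose y : Omega := fun n => if `[< C (e n) >] then x (e' (k1 * e n)) else x n.
have yC h : C h -> y (e' h) = x (e' (k1 * h)).
  by move=> Ch; rewrite /y e'K; case: asboolP.
have ynC h : ~ C h -> y (e' h) = x (e' h).
  by move=> nCh; rewrite /y e'K; case: asboolP.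
exists y; split.
- move=> h; have [k [Kk xk kP]] := Yx h.
  have [Ch|nCh] := pselect (C h); last first.
    exists k; split=> //; first by rewrite ynC// CK.
    by move=> l Kl; rewrite ynC ?CK//; apply: kP.
  have Kl : K (k1^-1 * k) by apply: subgroupM => //; exact: subgroupV.
  exists (k1^-1 * k); split=> //.
    by rewrite yC ?CK// mulgA mulVKg.
  move=> l Kl'; rewrite yC ?CK// mulgA => /kP <-; first by rewrite mulKg.
  exact: subgroupM.
- move=> yx; have [k [Kk xk kP]] := Yx g.
  have Kl : K (k1^-1 * k) by apply: subgroupM => //; exact: subgroupV.
  have Cl : C (k1^-1 * k * g) by exists (k1^-1 * k).
  have := yC _ Cl; rewrite yx mulgA mulVKg xk => /kP -/(_ Kl) k1E.
  apply: k1N1; apply: invg_inj; rewrite invg1.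
  by apply: (mulIg k); rewrite k1E mul1g.
- move=> i iN; rewrite /y; case: asboolP => // -[k Kk ik].
  by have := gP k Kk; rewrite -ik eK leqNgt iN.
Qed.

(** The inverse of the representative of [K] itself; taking the inverse turns right
    translation into left multiplication. *)
Let p (x : Omega) : G := xget 1 [set k | K k /\ x (e' k^-1)].

Let p_spec x : Y x -> [/\ K (p x), x (e' (p x)^-1) &
  forall k, K k -> x (e' k^-1) -> k = p x].
Proof.
move=> Yx; have [k [Kk xk kP]] := Yx 1.
have [|Kp xp] := @xgetPex _ 1 [set k | K k /\ x (e' k^-1)].
  exists k^-1; split; first exact: subgroupV.
  by rewrite invgK; rewrite mulg1 in xk.
split=> // h Kh xh; apply: invg_inj.
rewrite (kP h^-1) ?mulg1//; last exact: subgroupV.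
by rewrite (kP (p x)^-1) ?mulg1//; exact: subgroupV.
Qed.

Let p_translate k x : K k -> Y x -> p (translate k x) = k * p x.
Proof.
move=> Kk Yx; have [_ _ pk] := p_spec (transversals_translate k Yx).
have [Kp xp _] := p_spec Yx.
apply/esym/pk; first exact: subgroupM.
by rewrite translateE invgM mulgVK.
Qed.

Let p_determined : exists N, forall x y, agree N x y -> p x = p y.
Proof.
have [N NP] := coset_bound 1.
have NV k : K k -> (e' k^-1 < N)%N.
  by move=> Kk; rewrite -[k^-1]mulg1; apply: NP; exact: subgroupV.
exists N => x y xy; rewrite /p; congr (xget _ _).
by apply/seteqP; split=> k /= [Kk]; rewrite xy ?NV.
Qed.

(** Realizes on [Omega] itself, compatibly with a given colouring, the free action of
    [K] on the transversals together with its extension to [G]. *)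
Lemma free_action_of_coloring (X : Type) (c : Omega -> X) (N : nat) (phi : G -> X) :
  (forall x y, agree N x y -> c x = c y) ->
  (forall x, exists2 k, K k & c x = phi k) ->
  (forall k, K k -> exists x, c x = phi k) ->
  exists (sigma : Xi G) (q : Omega -> G),
    coordinate sigma K q /\ forall x, c x = phi (q x).
Proof.
move=> cN cphi phic.
have [M pM] := p_determined.
have imE : [set (phi \o p) x | x in Y] = c @` setT.
  apply/seteqP; split=> [_ [x Yx <-]|_ [x _ <-]].
    have [Kp _ _] := p_spec Yx.
    by have [y cy] := phic _ Kp; exists y.
  have [k Kk ->] := cphi x; have [y Yy] := transversals_nonempty.
  have [Kp _ _] := p_spec Yy.
  have Kkp : K (k * (p y)^-1) by apply: subgroupM => //; exact: subgroupV.
  exists (translate (k * (p y)^-1) y); first exact: transversals_translate.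
  by rewrite /= p_translate// mulgVK.
have [||||||||t [t' [tP t'P ct ut ut']]] :=
    @colored_homeo R X Y setT (phi \o p) c (maxn M N).
- exact: transversals_closed.
- exact: transversals_perfect.
- exact: closedT.
- move=> x L _; exists (fun n => if n == L then ~~ x n else x n); split=> //.
    by move=> /(congr1 (fun z => z L)); rewrite eqxx; case: (x L).
  by move=> i iL; rewrite ltn_eqF.
- by move=> x y _ _ xy; rewrite /= (pM x y)//; apply: agree_le xy; exact: leq_maxl.
- by move=> x y _ _ xy; apply: cN; apply: agree_le xy; exact: leq_maxr.
- exact: imE.
- by rewrite imE; exact: determined_finite_range cN.
have [|||sigma sE] := @exists_action G (fun g x => t (translate g (t' x))).
- move=> g; apply: ucont_continuous.
  apply: (@ucont_comp setT Y (translate g \o t') t) ut.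
    by move=> x _; apply: transversals_translate; exact: (t'P x I).1.
  apply: (@ucont_comp setT setT t' (translate g)) => //; exact: ucont_translate.
- by move=> x; rewrite translate1; exact: (t'P x I).2.
- move=> g h x; rewrite translateM (tP _ _).2//.
  by apply: transversals_translate; exact: (t'P x I).1.
have YP x : Y (t' x) by exact: (t'P x I).1.
exists sigma, (p \o t'); split; last first.
  by move=> x; rewrite -{1}(t'P x I).2 ct.
split.
- by move=> x; have [] := p_spec (YP x).
- by have [L LP] := ut' M; exists L => x y xy; apply: pM; exact: LP.
- move=> k x Kk; rewrite /= sE (tP _ _).2 ?p_translate//.
  exact: transversals_translate.
Qed.

End free_action.

(** * Towers are generic *)

(** A Rokhlin tower: the levels are the fibres of [p]. *)
Definition tower (G : groupType) (e : nat -> G) (n : nat) (rho : Xi G) :=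
  exists (K : set G) (p : Omega -> G), [/\ subgroup K, finite_set K,
    forall i, (i <= n)%N -> K (e i), coordinate rho K p &
    forall x y, p x = p y -> agree n x y].

Section towers.
Local Open Scope group_scope.
Variables (R : realType) (G : groupType) (e : nat -> G) (e' : G -> nat).
Hypotheses (eK : cancel e e') (e'K : cancel e' e).
Hypothesis lf : locally_finite_group G.

Lemma nbhs_Xi_close_finite (F : set G) (rho : Xi G) N : finite_set F ->
  nbhs rho [set sigma : Xi G | forall g, F g -> forall x, agree N (rho g x) (sigma g x)].
Proof.
move=> /finite_seqP[s ->]; elim: s => [|g s IH].
  by apply: (@filterS _ _ (nbhs_filter rho) setT) => //; exact: filterT.
apply: (@filterS _ _ (nbhs_filter rho) _ _ _ (filterI (nbhs_Xi_close rho g N) IH)).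
by move=> sigma [sg ss] h /=; rewrite inE => /predU1P[->|/ss].
Qed.

Lemma open_tower n : open (tower e n).
Proof.
rewrite openE => rho [K [p [sK finK Ke [pK [N pN] pM] pn]]].
apply: (@filterS _ _ (nbhs_filter rho) _ _ _ (nbhs_Xi_close_finite rho N finK)).
move=> sigma ss; exists K, p; split=> //; split=> //; first by exists N.
by move=> k x Kk; rewrite -pM//; apply/esym/pN/ss.
Qed.

Let group_infinite : ~ finite_set [set: G].
Proof.
move=> finG; suff : finite_set [set: nat] by exact: infinite_nat.
have := finite_image e' finG; congr finite_set.
by apply/seteqP; split=> n // _; exists (e n).
Qed.

(** The elements [g] with [kappa g = 1] represent the right cosets of [H]. *)
Lemma factor_fibre_infinite (H : set G) (kappa : G -> G) : finite_set H ->
  (forall g, H (kappa g)) -> (forall g, kappa ((kappa g)^-1 * g) = 1) ->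
  exists2 t : nat -> G, injective t & forall i, kappa (t i) = 1.
Proof.
move=> finH kH k1.
have infR : infinite_set (e' @` [set g | kappa g = 1]).
  move=> /(finite_image e); rewrite image_comp => finR; apply: group_infinite.
  apply: sub_finite_set (finite_image2 (fun h r => h * r) finH finR) => g _.
  exists (kappa g) => //; exists ((kappa g)^-1 * g); last by rewrite mulVKg.
  by exists ((kappa g)^-1 * g); [exact: k1 | rewrite /= e'K].
have /infiniteP/pcard_leP/unsquash f := infR.
exists (e \o f).
  by move=> i j /(can_inj eK)/inj; rewrite !inE; apply.
by move=> i; have [g gk gi] := @funS _ _ _ _ f i I; rewrite /= -gi e'K.
Qed.

(** A neighbourhood of [rho] only constrains the actions on a finite subgroup [H]; the
    group [K] of the tower can be any finite group that contains [H] and, for each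
    colour, a coset representative of [H] reserved for it. *)
Lemma dense_tower n : dense (tower e n).
Proof.
move=> O [rho0 Orho0] oO; have [rho Orho] : exists rho : Xi G, O rho by exists rho0.
have nO : nbhs rho O by exact: open_nbhs_nbhs.
have [F [N0 [finF N0O]]] := nbhs_Xi nO.
pose m := maxn n N0.
have [H [sH finH FH]] := finite_subset_subgroup lf finF.
(* The class of a point for [sim] serves as its colour. *)
pose sim x y := forall h, H h -> agree m (rho h x) (rho h y).
pose c x : set Omega := [set y | sim x y].
have simc x y : sim x y <-> c x = c y.
  split=> [xy|cxy].
    apply/seteqP; split=> z xz h Hh.
      by apply: agree_trans (xz h Hh); apply/agree_sym/xy.
    exact: agree_trans (xy h Hh) (xz h Hh).
  by have : c y y by []; rewrite -cxy.
have [||N cN] := @finite_common_bound _ H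
    (fun h N => forall x y, agree N x y -> agree m (rho h x) (rho h y)) finH.
- by move=> h M N MN hM x y /(agree_le MN)/hM.
- move=> h _; have [M MP] := continuous_ucont (@action_continuous G rho h) m.
  by exists M => x y; apply: MP.
have cdet x y : agree N x y -> c x = c y.
  by move=> xy; apply/simc => h Hh; apply: cN.
have [kappa [kH kM k1]] := coset_factor sH.
have [t tinj tk] := factor_fibre_infinite finH kH k1.
have /finite_seqP[s sE] := determined_finite_range cdet.
have /choice[xs xsP] i : exists x, (i < size s)%N -> c x = nth set0 s i.
  have [ilt|] := ltnP i (size s); last by exists point.
  have : (range c) (nth set0 s i) by rewrite sE /=; exact: mem_nth.
  by case=> x _ cx; exists x.
have /choice[t' t'P] g : exists i, (exists j, t j = g) -> t i = g.
  have [[j jg]|] := pselect (exists j, t j = g); first by exists j.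
  by exists 0%N.
have t'K i : t' (t i) = i by apply/tinj/t'P; exists i.
(* The equivariant map which sends the representative [t i] to [xs i], a point
   of the [i]-th colour. *)
pose v g := rho (kappa g) (xs (t' ((kappa g)^-1 * g))).
have vM h g : H h -> v (h * g) = rho h (v g).
  by move=> Hh; rewrite /v kM// invgM mulgA mulgVK actionM.
have vt i : v (t i) = xs i by rewrite /v tk invg1 mul1g t'K action1.
(* [e 0] and [e 1] cannot both be trivial, so that [K] will not be either. *)
have finS : finite_set (H `|` t @` `I_(size s) `|` e @` `I_n.+2).
  by rewrite !finite_setU; split; [split=> //|]; apply: finite_image; exact: finite_II.
have [K [sK finK SK]] := finite_subset_subgroup lf finS.
have Ke i : (i < n.+2)%N -> K (e i) by move=> i2; apply: SK; right; exists i.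
have [k [Kk kN1]] : exists k, K k /\ k <> 1.
  have [e0|] := pselect (e 0 = 1); last by exists (e 0); split=> //; apply: Ke.
  exists (e 1); split; first exact: Ke.
  by rewrite -e0 => /(can_inj eK).
have [||sigma [q [qK cq]]] := @free_action_of_coloring R G e e' eK e'K K k
    sK finK Kk kN1 _ c N (c \o v) cdet.
- move=> x; have : (range c) (c x) by exists x.
  rewrite sE /= => cs; exists (t (index (c x) s)).
    by apply: SK; left; right; exists (index (c x) s) => //=; rewrite index_mem.
  by rewrite /= vt xsP ?index_mem// nth_index.
- by move=> l Kl; exists (v l).
exists sigma; split.
- apply: N0O => g Fg x; have Hg : H g by exact: FH.
  suff /simc/(_ 1 (subgroup1 sH)) : c (rho g x) = c (sigma g x).
    by rewrite !action1; apply: agree_le; exact: leq_maxr.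
  have [_ _ qM] := qK.
  rewrite [RHS]cq /= qM; last by apply: SK; left; left.
  rewrite vM//; apply/simc => h Hh.
  have := (simc x (v (q x))).2 (cq x) _ (subgroupM sH Hh Hg).
  by rewrite (actionM rho h g x) (actionM rho h g (v (q x))).
- exists K, q; split=> //; first by move=> i ilen; apply: Ke; rewrite ltnS leqW.
  move=> x y qxy.
  have /simc/(_ 1 (subgroup1 sH)) : c x = c y by rewrite cq qxy -cq.
  by rewrite !action1; apply: agree_le; exact: leq_maxl.
Qed.

End towers.

(** * Visit frequencies along orbits of finite subgroups *)

Local Open Scope ring_scope.

Definition finite_card (T : choiceType) (S : set T) : nat := #|` fset_set S|.

Lemma subset_of_card (T : choiceType) (S : set T) i : finite_set S ->
  (i <= finite_card S)%N -> exists2 C, C `<=` S & finite_card C = i.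
Proof.
move=> finS iS; exists [set` [fset x in take i (fset_set S)]%fset].
  move=> x /=; rewrite !inE => /mem_take.
  by rewrite in_fset_set// => /set_mem.
rewrite /finite_card set_fsetK card_fseq undup_id; last first.
  by apply: take_uniq; exact: fset_uniq.
by rewrite size_takel.
Qed.

Section averages.
Variables (R : realType) (G : groupType).
Implicit Types (K L S : set G) (rho : Xi G) (a b : set Omega).

Lemma sum_indic_card K S : finite_set K ->
  \sum_(k \in K) (\1_S k : R) = (finite_card (K `&` S))%:R.
Proof.
move=> finK.
rewrite -(@fsbig_widen _ _ _ _ (K `&` S) K) => [||k [Kk nS]]; first last.
- by rewrite /= indicE memNset// => Sk; apply: nS.
- exact: subIsetl.
have finKS : finite_set (K `&` S) by exact: finite_setIl.
rewrite fsbig_finite// /finite_card -sum1_size natr_sum !big_seq.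
apply: eq_bigr => k; rewrite in_fset_set// => /set_mem[_ Sk].
by rewrite indicE mem_set.
Qed.

Lemma sum_translate_left K g (F : G -> R) : subgroup K -> K g ->
  \sum_(k \in K) F (g * k)%g = \sum_(k \in K) F k.
Proof.
move=> sK Kg; apply/esym/reindex_fsbig; split.
- by move=> k Kk; exact: subgroupM.
- by move=> k l _ _ /mulgI.
- move=> k Kk; exists (g^-1 * k)%g; last by rewrite mulVKg.
  by apply: subgroupM => //; exact: subgroupV.
Qed.

Lemma sum_translate_right K g (F : G -> R) : subgroup K -> K g ->
  \sum_(k \in K) F (k * g)%g = \sum_(k \in K) F k.
Proof.
move=> sK Kg; apply/esym/reindex_fsbig; split.
- by move=> k Kk; exact: subgroupM.
- by move=> k l _ _ /mulIg.
- move=> k Kk; exists (k * g^-1)%g; last by rewrite mulgVK.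
  by apply: subgroupM => //; exact: subgroupV.
Qed.

Lemma finite_card_gt0 K : subgroup K -> finite_set K -> (0 < finite_card K)%N.
Proof.
move=> sK finK; rewrite /finite_card cardfs_gt0; apply/fset0Pn; exists 1%g.
by rewrite in_fset_set// mem_set//; exact: subgroup1.
Qed.

Definition equidistributed rho K a (v : R) :=
  forall x, \sum_(k \in K) (\1_a (rho k x) : R) = v * (finite_card K)%:R.

(** Along an orbit of [K], the coordinate takes each value in [K] once. *)
Lemma coordinate_equidistributed rho K q S : subgroup K -> finite_set K ->
  coordinate rho K q ->
  equidistributed rho K (q @^-1` S)
    ((finite_card (K `&` S))%:R / (finite_card K)%:R).
Proof.
move=> sK finK [qK _ qM] x.
rewrite divfK ?pnatr_eq0 -?lt0n ?finite_card_gt0// -sum_indic_card//.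
rewrite -(sum_translate_right (\1_S) sK (qK x)).
by apply: eq_fsbigr => k /set_mem Kk; rewrite !indicE -qM//.
Qed.

(** An orbit of [L] is a union of orbits of [K].  To avoid choosing representatives of
    these orbits, the indicator of [a] is summed at all the points [k (l x)] in both
    orders. *)
Lemma equidistributed_sup rho K L a v : subgroup K -> finite_set K ->
  subgroup L -> finite_set L -> K `<=` L ->
  equidistributed rho K a v -> equidistributed rho L a v.
Proof.
move=> sK finK sL finL KL eqa x.
have K0 : (finite_card K)%:R != 0 :> R by rewrite pnatr_eq0 -lt0n finite_card_gt0.
apply: (mulIf K0).
transitivity (\sum_(k \in K) \sum_(l \in L) (\1_a (rho (k * l)%g x) : R)).
  transitivity (\sum_(k \in K) \sum_(l \in L) (\1_a (rho l x) : R)).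
    set s := \sum_(l \in L) _.
    rewrite fsbig_finite// big_seq.
    rewrite [LHS]mulr_natr.
    rewrite -(@big_seq _ _ _ _ (fset_set K) (fun=> s)) /=.
    by rewrite big_const_seq count_predT iter_addr_0.
  apply: eq_fsbigr => k /set_mem Kk; apply/esym.
  by apply: (sum_translate_left (fun l => \1_a (rho l x)) sL); exact: KL.
rewrite exchange_fsbig//.
transitivity (\sum_(l \in L) (v * (finite_card K)%:R)).
  apply: eq_fsbigr => l _; rewrite -(eqa (rho l x)).
  by apply: eq_fsbigr => k _; rewrite actionM.
rewrite fsbig_finite// big_const_seq count_predT iter_addr_0 -[LHS]mulr_natr.
by rewrite -/(finite_card L) mulrAC.
Qed.

Lemma equidistributed_unique rho K L a v w : locally_finite_group G ->
  subgroup K -> finite_set K -> subgroup L -> finite_set L ->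
  equidistributed rho K a v -> equidistributed rho L a w -> v = w.
Proof.
move=> lf sK finK sL finL av aw.
have [M [sM finM KLM]] : exists M, [/\ subgroup M, finite_set M & K `|` L `<=` M].
  by apply: finite_subset_subgroup => //; rewrite finite_setU.
have KM : K `<=` M by move=> k Kk; apply: KLM; left.
have LM : L `<=` M by move=> k Kk; apply: KLM; right.
have M0 : (finite_card M)%:R != 0 :> R by rewrite pnatr_eq0 -lt0n finite_card_gt0.
apply: (mulIf M0).
rewrite -(equidistributed_sup sK finK sM finM KM av point).
by rewrite -(equidistributed_sup sL finL sM finM LM aw point).
Qed.

End averages.

(** * Borel measures from clopen sets *)

(** By compactness, countable additivity is finite additivity on clopen sets. *)
Lemma clopen_trivIset_bigcup (F : nat -> set Omega) : (forall i, clopen (F i)) ->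
  trivIset setT F -> clopen (\bigcup_i F i) ->
  exists n, forall i, (n <= i)%N -> F i = set0.
Proof.
move=> cF tF [_ cU].
have := closed_compact_Omega cU; rewrite compact_cover.
case/(_ nat setT F) => [i _|//|D _ UD]; first by have [] := cF i.
have [||//|n nD] := @finite_common_bound _ [set` D] (fun i N => (i < N)%N).
- exact: finite_fset.
- by move=> i M N MN iM; apply: leq_trans MN.
- by move=> i _; exists i.+1.
exists n => i ni; apply/seteqP; split=> // x Fix.
have [|j Dj Fjx] := UD x; first by exists i.
have ij : i = j by apply: tF => //; exists x.
by have := nD j Dj; rewrite -ij ltnNge ni.
Qed.

Lemma open_bigcup_clopen (U : set Omega) : open U ->
  exists2 F : nat -> set Omega, (forall n, clopen (F n)) & U = \bigcup_n F n.
Proof.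
move=> /open_agree oU.
exists (fun n => [set x | forall y, agree n x y -> U y]).
  move=> n; apply/clopen_determined; exists n => x y xy xU z yz.
  by apply: xU; exact: agree_trans yz.
apply/seteqP; split=> [x /oU[n nU]|x [n _]]; first by exists n.
by apply.
Qed.

Lemma sigma_open_clopen : <<s @open Omega >> = <<s @clopen Omega >>.
Proof.
apply/seteqP; split.
  apply: smallest_sub; first exact: smallest_sigma_algebra.
  move=> U /open_bigcup_clopen[F cF ->].
  apply: sigma_algebra_bigcup => n; exact: sub_sigma_algebra.
apply: smallest_sub; first exact: smallest_sigma_algebra.
by move=> a [oa _]; exact: sub_sigma_algebra.
Qed.

Lemma clopen_measurable (a : set Omega) : clopen a -> measurable (a : set borel_Omega).
Proof. by case=> oa _; exact: sub_sigma_algebra. Qed.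

Lemma measure_eq_clopen (R : realType) (mu nu : {measure set borel_Omega -> \bar R}) :
  (mu setT < +oo)%E -> (forall a : set Omega, clopen a -> mu a = nu a) ->
  forall A : set borel_Omega, measurable A -> mu A = nu A.
Proof.
move=> muT munu.
apply: (@measure_unique _ R borel_Omega (@clopen Omega) (fun=> setT)) => //.
- exact: sigma_open_clopen.
- by move=> a b; exact: clopenI.
- by move=> _; exact: clopenT.
- by apply/seteqP; split=> // x _; exists 0%N.
Qed.

Lemma exists_probability d (T : measurableType d) (R : realType)
    (m : set T -> \bar R) : m set0 = 0%E -> (forall A, (0 <= m A)%E) ->
  semi_sigma_additive m -> m setT = 1%E ->
  exists P : probability T R, forall A, P A = m A.
Proof.
move=> m0 m_ge0 m_add mT.
pose mu : {measure set T -> \bar R} :=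
  HB.pack m (isMeasure.Build d T R m m0 m_ge0 m_add).
pose P : probability T R :=
  HB.pack (Measure.sort mu) (Measure_isProbability.Build d T R mu mT).
by exists P.
Qed.

(** A copy of [Omega] whose measurable sets are the clopen sets, on which a finitely
    additive function is a premeasure. *)
Definition clopen_Omega : Type := Omega.
HB.instance Definition _ := Pointed.on clopen_Omega.
Fact clopen_Omega_display : measure_display. Proof. exact: default_measure_display. Qed.
Fact clopen_Omega0 : @clopen Omega set0. Proof. exact: clopen0. Qed.
Fact clopen_OmegaU : setU_closed (@clopen Omega).
Proof. by move=> a b; exact: clopenU. Qed.
Fact clopen_OmegaC : setC_closed (@clopen Omega).
Proof. by move=> a; exact: clopenC. Qed.
HB.instance Definition _ := @isAlgebraOfSets.Build clopen_Omega_display clopen_Omega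
  (@clopen Omega) clopen_Omega0 clopen_OmegaU clopen_OmegaC.

(** The extension theorem for premeasures applies on the algebra of clopen sets, which
    generates the Borel sets. *)
Lemma probability_of_clopen_content (R : realType) (m : set Omega -> R) :
  (forall a, 0 <= m a) -> m setT = 1 ->
  (forall a b, clopen a -> clopen b -> a `&` b = set0 -> m (a `|` b) = m a + m b) ->
  exists mu : probability borel_Omega R, forall a, clopen a -> mu a = (m a)%:E.
Proof.
move=> m_ge0 mT mU.
have m0 : m set0 = 0.
  have /esym/eqP := mU set0 set0 (@clopen0 _) (@clopen0 _) (setI0 _).
  by rewrite setU0 -subr_eq0 addrK => /eqP.
pose c (a : set clopen_Omega) : \bar R := (m a)%:E.
have c0 : c set0 = 0%E by rewrite /c m0.
have c_ge0 a : (0 <= c a)%E by rewrite lee_fin.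
have c_add : semi_sigma_additive c.
  move=> F mF tF mUF.
  have [n nF] := clopen_trivIset_bigcup mF tF mUF.
  have sumF k : (\sum_(0 <= i < k) c (F i) = c (\bigcup_(i < k) F i))%E.
    elim: k => [|k IH].
      by rewrite big_geq// bigcup_mkord big_ord0 c0.
    rewrite big_nat_recr//= IH !bigcup_mkord big_ord_recr /= /c mU ?EFinD//.
    - by apply: (@bigsetU_measurable _ clopen_Omega).
    - exact: mF.
    - rewrite -bigcup_mkord; apply/seteqP; split=> // x [[i /= ik Fi] Fk].
      by have /eqP := tF i k I I (ex_intro _ x (conj Fi Fk)); rewrite ltn_eqF.
  apply: cvg_near_cst; exists n => // k /= nk.
  rewrite sumF; congr c; apply/seteqP; split=> [x [i _ Fi]|x [i _ Fi]]; exists i => //.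
  by apply: contrapT => /negP; rewrite -leqNgt => ki; move: Fi; rewrite nF// (leq_trans nk).
pose cm : {measure set clopen_Omega -> \bar R} :=
  HB.pack c (isMeasure.Build clopen_Omega_display clopen_Omega R c c0 c_ge0 c_add).
pose nu (A : set borel_Omega) : \bar R := measure_extension cm A.
have nuE a : clopen a -> nu a = (m a)%:E.
  by move=> ca; rewrite /nu /measure_extension measurable_mu_extE.
have nu0 : nu set0 = 0%E by rewrite nuE ?m0//; exact: clopen0.
have nu_ge0 A : (0 <= nu A)%E by exact: measure_ge0.
have meas (A : set borel_Omega) : measurable A ->
    measurable (A : set (g_sigma_algebraType (@measurable _ clopen_Omega))).
  by move=> mA; rewrite -[X in X A]/(<<s @clopen Omega >>) -sigma_open_clopen.
have nu_add : semi_sigma_additive nu.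
  move=> F mF tF mUF; apply: measure_semi_sigma_additive => //.
    by move=> i; apply: meas.
  exact: meas.
have nuT : nu setT = 1%E by rewrite nuE ?mT//; exact: clopenT.
have [P PE] := exists_probability nu0 nu_ge0 nu_add nuT.
by exists P => a ca; rewrite PE; exact: nuE.
Qed.

(** * Actions with towers of every height *)

Lemma finite_card_sub (T : choiceType) (A B : set T) : finite_set B -> A `<=` B ->
  (finite_card A <= finite_card B)%N.
Proof.
move=> finB AB; have finA : finite_set A by exact: sub_finite_set finB.
apply: fsubset_leq_card; apply/fsubsetP => x.
by rewrite !in_fset_set// => /set_mem /AB/mem_set.
Qed.

Lemma coordinate_clopen (G : groupType) (rho : Xi G) K q (S : set G) :
  coordinate rho K q -> clopen (q @^-1` S).
Proof.
case=> _ [N qN] _; apply/clopen_determined; exists N => x y xy /=.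
by rewrite (qN x y xy).
Qed.

Section invariant_measures.
Variables (R : realType) (G : groupType) (rho : Xi G).
Variable mu : probability borel_Omega R.
Hypothesis mu_inv : invariant_measure rho mu.
Variables (K : set G) (q : Omega -> G).
Hypotheses (sK : subgroup K) (finK : finite_set K) (qP : coordinate rho K q).

Let measurable_fibre (S : set G) : measurable (q @^-1` S : set borel_Omega).
Proof. by apply: clopen_measurable; exact: (coordinate_clopen S qP). Qed.

Lemma measure_bigcup_fibre (A : set borel_Omega) (S : set G) : measurable A ->
  mu (A `&` q @^-1` S) = (\sum_(k \in K `&` S) mu (A `&` q @^-1` [set k]))%E.
Proof.
move=> mA; rewrite -measure_fin_bigcup.
- congr (mu _); apply/seteqP; split=> [x [Ax Sx]|x [k [Kk Sk] [Ax /= ->]]] //.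
  by exists (q x) => //; split=> //; case: qP.
- exact: finite_setIl.
- by move=> k l _ _ [x [[_ /= <-] [_ /= <-]]].
- by move=> k _; apply: measurableI.
Qed.

(** [k^-1] maps the fibre over [k] to the fibre over [1]. *)
Lemma measure_fibre_eq k : K k -> mu (q @^-1` [set k]) = mu (q @^-1` [set 1%g]).
Proof.
move=> Kk; rewrite -(mu_inv k^-1%g (measurable_fibre [set 1%g])) /pushforward.
congr (mu _); apply/seteqP; split=> x /=; have [_ _ ->] := qP;
  try exact: subgroupV.
- by move=> ->; rewrite mulVg.
- by move=> /(congr1 (fun g => k * g)%g); rewrite mulVKg mulg1.
Qed.

Lemma measure_coordinate (S : set G) :
  mu (q @^-1` S) = ((finite_card (K `&` S))%:R / (finite_card K)%:R)%:E.
Proof.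
pose r := fine (mu (q @^-1` [set 1%g])).
have rE : mu (q @^-1` [set 1%g]) = r%:E.
  by rewrite fineK// fin_num_measure.
have H (T : set G) : mu (q @^-1` T) = (r * (finite_card (K `&` T))%:R)%:E.
  have := @measure_bigcup_fibre setT T measurableT; rewrite setTI => ->.
  transitivity (\sum_(k \in K `&` T) r%:E)%E.
    by apply: eq_fsbigr => k /set_mem[Kk _]; rewrite setTI measure_fibre_eq.
  rewrite fsumEFin; last exact: finite_setIl.
  rewrite fsbig_finite; last exact: finite_setIl.
  by rewrite big_const_seq count_predT iter_addr_0 -[in LHS]mulr_natr.
have K0 : (finite_card K)%:R != 0 :> R by rewrite pnatr_eq0 -lt0n finite_card_gt0.
have := H setT; rewrite preimage_setT probability_setT setIT => -[rK].
rewrite H; congr (_%:E); apply: (mulIf K0).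
by rewrite divfK// mulrAC -rK mul1r.
Qed.

End invariant_measures.

Section generic_actions.
Variables (R : realType) (G : groupType) (e : nat -> G) (e' : G -> nat).
Hypotheses (eK : cancel e e') (e'K : cancel e' e).
Hypothesis lf : locally_finite_group G.
Variable rho : Xi G.
Hypothesis towers : forall n, tower e n rho.

(** Every orbit meets every fibre of [p], since [K] permutes the fibres transitively, and
    the fibre of [x] lies in any given neighbourhood of [x] if the tower is high. *)
Lemma tower_minimal : minimal_action rho.
Proof.
move=> F cF [y Fy] rhoF; apply/seteqP; split=> // x _.
apply: contrapT => nFx.
have /open_agree/(_ x nFx)[N NF] := closed_openC cF.
have [K [p [sK finK _ [pK _ pM] pN]]] := towers N.
apply: (NF (rho (p x * (p y)^-1)%g y)).
  apply: pN; rewrite pM ?mulgVK//.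
  by apply: subgroupM => //; exact: subgroupV.
by apply: rhoF; exists y.
Qed.

(** A clopen set depends on finitely many coordinates, hence is a union of fibres of the
    base map of any high enough tower. *)
Lemma clopen_coordinate (a : set Omega) : clopen a -> exists N, forall n p,
  (N <= n)%N -> (forall x y, p x = p y :> G -> agree n x y) -> a = p @^-1` (p @` a).
Proof.
move=> /clopen_determined[N aN]; exists N => n p Nn pn.
apply/seteqP; split=> x; first by move=> ax; exists x.
by move=> [y ay /pn /(agree_le Nn) yx]; exact: aN yx ay.
Qed.

(** The frequency with which the orbits of large finite subgroups visit [a]; the value
    [0] is a default for the sets without such a frequency. *)
Definition density (a : set Omega) : R :=
  xget 0 [set v | exists K, [/\ subgroup K, finite_set K & equidistributed rho K a v]].

Lemma densityE K a v : subgroup K -> finite_set K -> equidistributed rho K a v ->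
  density a = v.
Proof.
move=> sK finK av.
have [|L [sL finL aL]] := @xgetPex _ 0 [set v : R | exists K,
    [/\ subgroup K, finite_set K & equidistributed rho K a v]].
  by exists v, K.
exact: equidistributed_unique lf sL finL sK finK aL av.
Qed.

Lemma clopen_equidistributed a : clopen a -> exists K,
  [/\ subgroup K, finite_set K & equidistributed rho K a (density a)].
Proof.
move=> ca; have [N aN] := clopen_coordinate ca.
have [K [p [sK finK _ pP pN]]] := towers N.
exists K; split=> //.
have aE := aN N p (leqnn N) pN.
have := @coordinate_equidistributed R G rho K p (p @` a) sK finK pP.
by rewrite -aE => av; rewrite (densityE sK finK av).
Qed.

Lemma density_ge0 a : 0 <= density a.
Proof.
rewrite /density; case: xgetP => // v _ [K [sK finK av]].
have K0 : 0 < (finite_card K)%:R :> R by rewrite ltr0n finite_card_gt0.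
by rewrite -(pmulr_lge0 _ K0) -(av point); apply: fsumr_ge0.
Qed.

Lemma densityT : density setT = 1.
Proof.
have [K [p [sK finK _ _ _]]] := towers 0.
by apply: (densityE sK finK) => x; rewrite mul1r -[in RHS](setIT K) -sum_indic_card.
Qed.

Lemma densityU a b : clopen a -> clopen b -> a `&` b = set0 ->
  density (a `|` b) = density a + density b.
Proof.
move=> ca cb ab0.
have [K [sK finK aK]] := clopen_equidistributed ca.
have [L [sL finL bL]] := clopen_equidistributed cb.
have [M [sM finM KLM]] : exists M, [/\ subgroup M, finite_set M & K `|` L `<=` M].
  by apply: finite_subset_subgroup => //; rewrite finite_setU.
apply: (densityE sM finM) => x; rewrite mulrDl.
rewrite -(equidistributed_sup sK finK sM finM _ aK x); last first.
  by move=> k Kk; apply: KLM; left.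
rewrite -(equidistributed_sup sL finL sM finM _ bL x); last first.
  by move=> k Kk; apply: KLM; right.
rewrite -fsbig_split//; apply: eq_fsbigr => k _.
rewrite !indicE in_setU; set y := rho k x.
have [ya|] := boolP (y \in a); have [yb|] := boolP (y \in b); rewrite /= ?(addr0, add0r)//.
have : (a `&` b) y by split; exact: set_mem.
by rewrite ab0.
Qed.

(** If [g] is in [M], left multiplication by [g] permutes [M], so that [a] and its
    preimage by [g] are visited equally often by an orbit of [M]. *)
Lemma density_invariant g a : clopen a -> density (rho g @^-1` a) = density a.
Proof.
move=> ca; have [K [sK finK aK]] := clopen_equidistributed ca.
have [M [sM finM KgM]] : exists M, [/\ subgroup M, finite_set M & K `|` [set g] `<=` M].
  by apply: finite_subset_subgroup => //; rewrite finite_setU.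
have KM : K `<=` M by move=> k Kk; apply: KgM; left.
apply: (densityE sM finM) => x.
rewrite -(equidistributed_sup sK finK sM finM KM aK x).
have Mg : M g by apply: KgM; right.
rewrite -(sum_translate_left (fun k => \1_a (rho k x) : R) sM Mg).
by apply: eq_fsbigr => k _; rewrite actionM.
Qed.

Lemma action_measurable g :
  measurable_fun setT (rho g : borel_Omega -> borel_Omega).
Proof.
apply: (@measurability _ _ borel_Omega borel_Omega setT (rho g) (@open Omega)) => //.
move=> _ [U oU <-]; rewrite setTI; apply: sub_sigma_algebra.
by apply: open_comp oU => x _; exact: action_continuous.
Qed.

Lemma tower_invariant_measure : exists mu : probability borel_Omega R,
  invariant_measure rho mu.
Proof.
have [mu muE] := probability_of_clopen_content density_ge0 densityT densityU.
exists mu => g A mA.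
pose nu : {measure set borel_Omega -> \bar R} :=
  measure_function_pushforward__canonical__measure_function_Measure mu (action_measurable g).
apply: (measure_eq_clopen (mu := nu)) => //.
  by rewrite /nu /= /pushforward preimage_setT probability_setT ltry.
move=> a ca; rewrite /nu /= /pushforward !muE ?density_invariant//.
by apply: preimage_clopen ca _; exact: action_continuous.
Qed.

Lemma tower_uniquely_ergodic : uniquely_ergodic R rho.
Proof.
have [mu mu_inv] := tower_invariant_measure.
exists mu => // nu nu_inv.
have nuE a : clopen a -> nu a = mu a.
  move=> ca; have [N aN] := clopen_coordinate ca.
  have [K [p [sK finK _ pP pN]]] := towers N.
  by rewrite (aN N p (leqnn N) pN) !(measure_coordinate _ sK finK pP).
by apply: (measure_eq_clopen _ nuE); rewrite -ge0_fin_numE// fin_num_measure.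
Qed.

Variable mu : probability borel_Omega R.
Hypothesis mu_inv : invariant_measure rho mu.

Lemma tower_full_support : full_support mu.
Proof.
move=> U oU [x Ux]; have /open_agree/(_ x Ux)[N NU] := oU.
have [K [p [sK finK _ pP pN]]] := towers N.
apply: (@lt_le_trans _ _ (mu (p @^-1` [set p x]))).
  rewrite (measure_coordinate mu_inv sK finK pP) lte_fin divr_gt0//.
    rewrite ltr0n /finite_card cardfs_gt0; apply/fset0Pn; exists (p x).
    rewrite in_fset_set; last exact: finite_setIl.
    by rewrite mem_set//; split=> //; case: pP.
  by rewrite ltr0n finite_card_gt0.
apply: le_measure; rewrite ?inE.
- by apply: clopen_measurable; exact: (coordinate_clopen _ pP).
- exact: sub_sigma_algebra.
- by move=> y /= /esym/pN/NU.
Qed.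

Lemma finite_card_enum n (K : set G) : finite_set K ->
  (forall i, (i <= n)%N -> K (e i)) -> (n < finite_card K)%N.
Proof.
move=> finK Ke; apply: leq_card_fset_set => //.
apply: (@card_le_trans _ _ _ (e @` `I_n.+1)).
  have /card_eqPle[] // : e @` `I_n.+1 #= `I_n.+1.
  by apply: inj_card_eq => i j _ _ /(can_inj eK).
by apply: subset_card_le => _ [i /= i_n <-]; apply: Ke.
Qed.

(** The fibres of a high tower have mass smaller than that of [A], and one of them cuts
    [A] in a set of positive mass. *)
Lemma tower_atomless : atomless mu.
Proof.
move=> A mA A0.
have [r rE] : exists r, mu A = r%:E.
  by exists (fine (mu A)); rewrite fineK// fin_num_measure.
have r0 : 0 < r by rewrite -lte_fin -rE.
have [n nr] : exists n, n.+1%:R^-1 < r.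
  exists (Num.truncn r^-1); rewrite invf_plt ?posrE//.
  exact: truncnS_gt.
have [K [p [sK finK Ke pP pN]]] := towers n.
have [k Kk Ak] : exists2 k, K k & (0 < mu (A `&` p @^-1` [set k]))%E.
  apply: contrapT => /forall2NP noK.
  move: A0; rewrite -[A]setIT -(@preimage_setT _ _ p) (measure_bigcup_fibre mu finK pP)//.
  rewrite fsbig1 ?ltxx// => k [Kk _].
  by have [//|/negP] := noK k; rewrite -leNgt => ?; apply/eqP; rewrite eq_le measure_ge0 andbT.
have mk : measurable (p @^-1` [set k] : set borel_Omega).
  by apply: clopen_measurable; exact: (coordinate_clopen _ pP).
exists (A `&` p @^-1` [set k]).
  by split; [exact: measurableI | exact: subIsetl].
rewrite Ak /=; apply: (@le_lt_trans _ _ (mu (p @^-1` [set k]))).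
  by apply: le_measure; rewrite ?inE//; exact: measurableI.
rewrite (measure_coordinate mu_inv sK finK pP) rE lte_fin; apply: le_lt_trans nr.
have -> : K `&` [set k] = [set k] by apply/seteqP; split=> [l []//|l /= ->].
rewrite /finite_card fset_set1 cardfs1 mul1r lef_pV2 ?posrE ?ltr0n//.
  by rewrite ler_nat; exact: finite_card_enum.
exact: finite_card_gt0.
Qed.

(** In a high tower, [a] and [b] are unions of [i] and [j] fibres, with [i < j]; any [i]
    of the fibres that make up [b] will do. *)
Lemma tower_good : good_measure mu.
Proof.
split; [exact: tower_atomless | exact: tower_full_support |].
move=> a b ca cb ab.
have [N aN] := clopen_coordinate ca; have [M bM] := clopen_coordinate cb.
have [K [p [sK finK _ pP pN]]] := towers (maxn N M).
have aE := aN _ p (leq_maxl N M) pN; have bE := bM _ p (leq_maxr N M) pN.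
have muE S := measure_coordinate mu_inv sK finK pP S.
have cardlt : (finite_card (K `&` p @` a) <= finite_card (K `&` p @` b))%N.
  move: ab; rewrite [in mu a]aE [in mu b]bE !muE lte_fin.
  rewrite ltr_pM2r ?invr_gt0 ?ltr0n ?finite_card_gt0// ltr_nat.
  exact: ltnW.
have [|C CK Ccard] := subset_of_card _ cardlt; first exact: finite_setIl.
exists (p @^-1` C); split.
- exact: coordinate_clopen pP.
- by rewrite [X in _ `<=` X]bE => x /CK[].
- rewrite [in mu a]aE !muE -Ccard.
  rewrite (_ : K `&` C = C)//; apply/seteqP; split=> [x []//|x Cx].
  by split=> //; have [] := CK x Cx.
Qed.

(** For a value [i / #|K0|], the map [kappa : G -> K0] turns the base map of a tower
    whose group contains [K0] into a coordinate for [K0] itself. *)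
Lemma tower_clopen_value_set : clopen_value_set mu = V_ G.
Proof.
apply/seteqP; split=> [_ [a ca <-]|_ [K0 [i [sK0 finK0 iK0 ->]]]].
  have [N aN] := clopen_coordinate ca.
  have [K [p [sK finK _ pP pN]]] := towers N.
  exists K, (finite_card (K `&` p @` a)); split=> //.
    by apply: finite_card_sub => //; exact: subIsetl.
  by rewrite [in LHS](aN N p (leqnn N) pN) (measure_coordinate mu_inv sK finK pP).
have [||//|N NK0] := @finite_common_bound _ K0 (fun k N => (e' k <= N)%N).
- exact: finK0.
- by move=> k M N MN kM; exact: leq_trans MN.
- by move=> k _; exists (e' k).
have [K [p [sK finK Ke [pK [M pM] pM'] pN]]] := towers N.
have [kappa [kK0 kM _]] := coset_factor sK0.
have qP : coordinate rho K0 (kappa \o p).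
  split=> [x|| k x K0k]; first exact: kK0.
  - by exists M => x y /pM /= ->.
  - by rewrite /= pM' ?kM// -(e'K k); apply: Ke; exact: NK0.
have [C CK0 Ccard] := subset_of_card finK0 iK0.
exists ((kappa \o p) @^-1` C); first exact: coordinate_clopen qP.
rewrite (measure_coordinate mu_inv sK0 finK0 qP) /= (_ : K0 `&` C = C) ?Ccard//.
by apply/seteqP; split=> [x []//|x Cx]; split=> //; exact: CK0.
Qed.

End generic_actions.

Theorem theorem7p11 (R : realType) (G : groupType)
    (hcount : [set: G] #= [set: nat]) (hlf : locally_finite_group G) :
  comeager [set rho : Xi G |
    [/\ minimal_action rho,
        uniquely_ergodic R rho &
        forall mu : probability borel_Omega R, invariant_measure rho mu ->
          good_measure mu /\ clopen_value_set mu = V_ G]].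
Proof.
have [e [e' [eK e'K]]] : exists (e : nat -> G) (e' : G -> nat), cancel e e' /\ cancel e' e.
  have /pcard_eqP/unsquash f := hcount.
  have bf : bijective f by rewrite -setTT_bijective; exact: bij.
  by case: bf => f' fK f'K; exists f', f.
exists (\bigcap_n tower e n).
  exists (tower e) => // n; split; first exact: open_tower.
  exact: (@dense_tower R G e e').
move=> rho rhoT.
have towers n : tower e n rho by exact: rhoT.
split.
- exact: tower_minimal towers.
- exact: tower_uniquely_ergodic hlf _ towers.
- move=> mu mu_inv; split; first exact: (tower_good eK towers mu_inv).
  exact: (tower_clopen_value_set e'K towers mu_inv).
Qed.
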